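(* Let $X$ be a compact subset of the Euclidean space $\mathbb{R}^{N}$ and let $(T_{n})_{n}$ be a sequence of sublinear and monotone operators from $C(X)$ into itself such that $$T_{n}(f)(x)\rightarrow f(x)\quad\text{uniformly on }X$$ for each of the test functions $f\in\{1,\ \pm\operatorname{pr}_{1},\dots,\pm\operatorname{pr}_{N},\ \sum_{k=1}^{N}\operatorname{pr}_{k}^{2}\}$ (restricted to $X$). Then $$\lim_{n\rightarrow\infty}T_{n}(f)=f\quad\text{uniformly on }X$$ for all nonnegative functions $f\in C(X)$. Moreover, if the operators $T_{n}$ are also translatable, then this convergence holds for all functions $f\in C(X)$.
   Context: $C(X)$ is the space of all real-valued continuous functions on $X$, with the pointwise order; $1$ denotes the constant function equal to one. For $k=1,\dots,N$, $\operatorname{pr}_{k}:(x_{1},\dots,x_{N})\mapsto x_{k}$ is the canonical projection on $\mathbb{R}^N$. A (not necessarily linear) operator $T:C(X)\to C(X)$ is called: - sublinear if $T(f+g)\leq T(f)+T(g)$ and $T(af)=aT(f)$ for all $f,g\in C(X)$ and all real $a\geq 0$; - monotone if $f\leq g$ implies $T(f)\leq T(g)$; - translatable if $T(f+\alpha\cdot 1)=T(f)+\alpha T(1)$ for all $f\in C(X)$ and all real $\alpha\geq 0$. *)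

(* Defs.v *)
From HB Require Import structures.
From mathcomp Require Import all_boot all_order all_algebra.
From mathcomp Require Import all_classical all_reals all_analysis.

Set Implicit Arguments.
Unset Strict Implicit.
Unset Printing Implicit Defensive.

Import Order.TTheory GRing.Theory Num.Theory.
Import numFieldNormedType.Exports.

Local Open Scope classical_set_scope.
Local Open Scope ring_scope.

Section ContinuousAlgebra.
Context {S : topologicalType} {R : realType}.
Implicit Types f g : continuousType S R.

Lemma ctsD_subproof f g : continuous (fun x => f x + g x).
Proof. by move=> x; apply: continuousD; exact: cts_fun. Qed.

Lemma ctsN_subproof f : continuous (fun x => - f x).
Proof. by move=> x; apply: continuousN; exact: cts_fun. Qed.

Lemma ctsM_subproof f g : continuous (fun x => f x * g x).
Proof. by move=> x; apply: continuousM; exact: cts_fun. Qed.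

Lemma ctsC_subproof (a : R) : continuous (fun _ : S => a).
Proof. by move=> x; exact: cvg_cst. Qed.

Lemma ctsZ_subproof (a : R) f : continuous (fun x => a * f x).
Proof. by move=> x; apply: continuousM; [exact: cvg_cst | exact: cts_fun]. Qed.

Definition cts_const (a : R) : continuousType S R := mkcts (@ctsC_subproof a).
Definition cts_add f g : continuousType S R := mkcts (@ctsD_subproof f g).
Definition cts_opp f : continuousType S R := mkcts (@ctsN_subproof f).
Definition cts_mul f g : continuousType S R := mkcts (@ctsM_subproof f g).
Definition cts_scale (a : R) f : continuousType S R :=
  mkcts (@ctsZ_subproof a f).

Lemma cts_addA : associative cts_add.
Proof. by move=> f g h; apply/continuousEP => x; exact: addrA. Qed.
Lemma cts_addC : commutative cts_add.
Proof. by move=> f g; apply/continuousEP => x; exact: addrC. Qed.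
Lemma cts_add0 : left_id (cts_const 0) cts_add.
Proof. by move=> f; apply/continuousEP => x; exact: add0r. Qed.
Lemma cts_addN : left_inverse (cts_const 0) cts_opp cts_add.
Proof. by move=> f; apply/continuousEP => x; exact: addNr. Qed.

HB.instance Definition _ := GRing.isZmodule.Build (continuousType S R)
  cts_addA cts_addC cts_add0 cts_addN.

Lemma cts_mulA : associative cts_mul.
Proof. by move=> f g h; apply/continuousEP => x; exact: mulrA. Qed.
Lemma cts_mulC : commutative cts_mul.
Proof. by move=> f g; apply/continuousEP => x; exact: mulrC. Qed.
Lemma cts_mul1 : left_id (cts_const 1) cts_mul.
Proof. by move=> f; apply/continuousEP => x; exact: mul1r. Qed.
Lemma cts_mulD : left_distributive cts_mul cts_add.
Proof. by move=> f g h; apply/continuousEP => x; exact: mulrDl. Qed.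

HB.instance Definition _ := GRing.Zmodule_isComPzRing.Build
  (continuousType S R) cts_mulA cts_mulC cts_mul1 cts_mulD.

Lemma cts_scaleA (a b : R) f :
  cts_scale a (cts_scale b f) = cts_scale (a * b) f.
Proof. by apply/continuousEP => x; exact: mulrA. Qed.
Lemma cts_scale1 : left_id 1 cts_scale.
Proof. by move=> f; apply/continuousEP => x; exact: mul1r. Qed.
Lemma cts_scaleDr : right_distributive cts_scale +%R.
Proof. by move=> a f g; apply/continuousEP => x; exact: mulrDr. Qed.
Lemma cts_scaleDl f : {morph cts_scale^~ f : a b / a + b}.
Proof. by move=> a b; apply/continuousEP => x; exact: mulrDl. Qed.

HB.instance Definition _ := GRing.Zmodule_isLmodule.Build R
  (continuousType S R) cts_scaleA cts_scale1 cts_scaleDr cts_scaleDl.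

Definition ctsle f g : Prop := forall x, f x <= g x.

Lemma cts_addE f g x : (f + g) x = f x + g x. Proof. by []. Qed.
Lemma cts_oppE f x : (- f) x = - f x. Proof. by []. Qed.
Lemma cts_mulE f g x : (f * g) x = f x * g x. Proof. by []. Qed.
Lemma cts_scaleE (a : R) f x : (a *: f) x = a * f x. Proof. by []. Qed.
Lemma cts_zeroE x : (0 : continuousType S R) x = 0. Proof. by []. Qed.
Lemma cts_oneE x : (1 : continuousType S R) x = 1. Proof. by []. Qed.

Implicit Type T : continuousType S R -> continuousType S R.

Definition sublinear_operator T : Prop :=
  (forall f g, ctsle (T (f + g)) (T f + T g)) /\
  (forall (a : R) f, 0 <= a -> T (a *: f) = a *: T f).

Definition monotone_operator T : Prop := forall f g, ctsle f g -> ctsle (T f) (T g).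

Definition translatable_operator T : Prop :=
  forall f (a : R), 0 <= a -> T (f + a *: (1 : continuousType S R)) = T f + a *: T 1.

Definition tends_uniformly (u : nat -> continuousType S R) f : Prop :=
  {uniform, (fun n => u n : S -> R) @ \oo --> (f : S -> R)}.

End ContinuousAlgebra.

Section Projections.
Context {R : realType} {N : nat} (X : set 'rV[R]_N).

Lemma pr_subproof (k : 'I_N) : continuous (fun x : X => set_val x ord0 k).
Proof.
move=> x; apply: (@continuous_comp _ _ _ set_val (fun v : 'rV[R]_N => v ord0 k)).
  exact: initial_continuous.
exact: coord_continuous.
Qed.

(* [X] is coerced to the subtype of its points, which carries the topology
   induced from 'rV[R]_N, i.e. the Euclidean topology. *)
Definition pr (k : 'I_N) : continuousType X R := mkcts (@pr_subproof k).

End Projections.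

(* Main.v *)
Require Import Defs.
From HB Require Import structures.
From mathcomp Require Import all_boot all_order all_algebra.
From mathcomp Require Import lra ring.
From mathcomp Require Import all_classical all_reals all_analysis.

Set Implicit Arguments.
Unset Strict Implicit.
Unset Printing Implicit Defensive.

Import Order.TTheory GRing.Theory Num.Theory.
Import numFieldNormedType.Exports.

Local Open Scope classical_set_scope.
Local Open Scope ring_scope.

(** Fix a point x and let d(x,t) be the squared distance from x to t.  On a
    compact X, a continuous f satisfies, for every e > 0 and some c >= 0,
    |f t - f x| <= e + c * d(x,t) for all x and t ([compact_modulus]).  Read as
    inequalities between functions of t, these are
      f <= (f x + e) * 1 + c * d(x,.)   and
      (f x) * 1 <= f + e * 1 + c * d(x,.).
    When f x >= 0 every coefficient is nonnegative, so a sublinear monotone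
    operator T may be applied to both, and evaluation at t = x gives
      |T f x - f x| <= f x * |T 1 x - 1| + e * T 1 x + c * T (d(x,.)) x
    ([sublinear_monotone_pointwise]).  As T_n 1 tends to 1, all that remains is
    that T_n (d(x,.)) x becomes small uniformly in x.

    Now d(x,.) = |x|^2 * 1 - 2 * sum_k x_k pr_k + sum_k pr_k^2 is a combination
    of the test functions, with coefficients bounded in x.  A sublinear T is
    controlled from above only on combinations with nonnegative coefficients;
    this is why both pr_k and -pr_k are test functions: -2 x_k pr_k is written
    (|x_k| + x_k) * (- pr_k) + (|x_k| - x_k) * pr_k.  Subadditivity then bounds
    T_n (d(x,.)) x by the value at x of the same combination of the T_n g, where
    g runs through the test functions, and this tends uniformly to
    d(x,x) = 0 ([diagonal_upper_sqdist]).

    For a translatable T_n and an f of any sign, add a constant that makes f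
    nonnegative and subtract its image afterwards ([translatable_shift]). *)

(** * Compactness and uniform convergence *)

(** The topology on the type of points of A is the initial one, so a
    cluster point in U of the pushed forward filter, lying in A, is a cluster
    point in A. *)
Lemma compact_set_type (U : topologicalType) (A : set U) :
  compact A -> compact [set: A].
Proof.
move=> cA F PF _.
have FA : F (set_val @^-1` A) by apply: filterE => x; exact: set_valP.
have [x [Ax clx]] := cA (set_val @ F) _ FA.
exists (exist _ x (mem_set Ax)); split => // P B FP [_ [[W oW <-] Wx sWB]].
have FvP : F (set_val @^-1` (set_val @` P)).
  by apply: filterS FP => y Py; exists y.
have Wnx : nbhs x W by apply: open_nbhs_nbhs; split => //.
have [_ [[y Py <-] Wy]] := clx _ _ FvP Wnx.
by exists y; split => //; exact: sWB.
Qed.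

Section UniformEstimates.
Context {S : topologicalType} {R : realType}.
Implicit Types f g : continuousType S R.

Lemma tends_uniformlyP (u : nat -> continuousType S R) f :
  tends_uniformly u f <->
  forall e : R, 0 < e -> \forall n \near \oo, forall x, `|u n x - f x| <= e.
Proof.
rewrite /tends_uniformly uniform_nbhsT; split.
  move=> /cvg_fct_entourageP uf e e0.
  have ball_e : \forall n \near \oo, forall x, ball (f x) e (u n x).
    exact: uf _ (entourage_ball R (PosNum e0)).
  apply: filterS ball_e => n ufn x.
  by rewrite distrC ltW //; have := ufn x; rewrite -ball_normE.
move=> uf; apply/cvg_fct_entourageP => A.
rewrite -entourage_ballE => -[e /= e0 eA].
have e20 : 0 < e / 2 by rewrite divr_gt0.
suff : \forall n \near \oo, forall x, A (f x, u n x) by [].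
apply: filterS (uf _ e20) => n ufn x; apply: eA => /=.
rewrite -ball_normE /= distrC (le_lt_trans (ufn x)) //.
by rewrite ltr_pdivrMr // ltr_pMr // ltr1n.
Qed.

Lemma continuous_compact_bounded f :
  compact [set: S] -> exists2 M : R, 0 <= M & forall x, `|f x| <= M.
Proof.
move=> cS.
have /compact_bounded [M [_ bM]] : compact (f @` setT).
  apply: continuous_compact => //.
  by apply: continuous_subspaceT; exact: cts_fun.
exists (`|M| + 1); first by rewrite addr_ge0.
move=> x; apply: bM; last by exists x.
by rewrite (le_lt_trans (ler_norm _)) // ltrDl.
Qed.

Lemma continuous_increment f : continuous (fun p : S * S => f p.2 - f p.1).
Proof.
move=> p; apply: cvgB.
  by apply: (@continuous_comp _ _ _ snd f p); [exact: cvg_snd|exact: cts_fun].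
by apply: (@continuous_comp _ _ _ fst f p); [exact: cvg_fst|exact: cts_fun].
Qed.

(** D only has to be continuous and to separate points: near a pair (x, x) the
    left side is below e, and near any other pair D is bounded away from 0, so a
    large multiple of it wins.  Compactness of S * S makes one integer multiple
    suffice for all pairs, since the bound improves as the multiple grows. *)
Lemma compact_modulus (D : S -> S -> R) f :
  compact [set: S] -> continuous (fun p : S * S => D p.1 p.2) ->
  (forall x t, 0 <= D x t) -> (forall x t, D x t = 0 -> x = t) ->
  forall e : R, 0 < e ->
  exists2 c : R, 0 <= c & forall x t, `|f t - f x| <= e + c * D x t.
Proof.
move=> cS cD D0 Dsep e e0.
have /compact_near_coveringP := compact_setX cS cS.
have cf : continuous (fun p : S * S => `|f p.2 - f p.1|).
  by move=> p; apply: cvg_norm; exact: continuous_increment.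
move=> /(_ nat \oo (fun n p => `|f p.2 - f p.1| < e + n%:R * D p.1 p.2)) [].
- move=> [x t] _.
  have [m mE] : exists m : nat, `|f t - f x| < e + m%:R * D x t.
    have [/eqP /Dsep ->|Dxt] := boolP (D x t == 0).
      by exists 0%N; rewrite subrr normr0 mul0r addr0.
    have Dp : 0 < D x t by rewrite lt_neqAle eq_sym Dxt D0.
    exists (Num.truncn (`|f t - f x| / D x t)).+1.
    rewrite -[X in X < _]add0r ltrD // -ltr_pdivrMr //.
    exact: truncnS_gt.
  near=> p n => /=.
  have mn : m%:R <= n%:R :> R.
    rewrite ler_nat; near: n; exact: nbhs_infty_ge.
  have : `|f p.2 - f p.1| - m%:R * D p.1 p.2 < e.
    near: p.
    have c : continuous (fun p : S * S => `|f p.2 - f p.1| - m%:R * D p.1 p.2).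
      move=> p; apply: cvgB; first exact: cf.
      by apply: cvgM; [exact: cvg_cst|exact: cD].
    apply: (c (x, t) [set y | y < e]).
    by apply: open_nbhs_nbhs; split; [exact: open_lt|rewrite /= ltrBlDr].
  rewrite ltrBlDr => /lt_le_trans; apply; rewrite lerD2l.
  by rewrite ler_wpM2r.
- move=> m _ /(_ m (leqnn m)) mP; exists m%:R => // x t.
  by apply: ltW; exact: (mP (x, t)).
Unshelve. all: by end_near. Qed.

(** * Estimates for sublinear operators *)

Lemma cts_sumE (I : Type) (r : seq I) (g : I -> continuousType S R) x :
  (\sum_(i <- r) g i) x = \sum_(i <- r) g i x.
Proof. by elim/big_rec2: _ => // i y1 y2 _ <-. Qed.

Lemma cts_exprE f n x : (f ^+ n) x = f x ^+ n.
Proof. by elim: n => [//|n IH]; rewrite !exprS cts_mulE IH. Qed.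

Lemma ler_mul_div_succ (c e : R) : 0 <= c -> 0 <= e -> c * (e / (c + 1)) <= e.
Proof.
move=> c0 e0; have c1 : 0 < c + 1 by rewrite ltr_wpDl.
by rewrite mulrCA ler_piMr // ler_pdivrMr // mul1r lerDl.
Qed.

(** The operator is applied to a function depending on the point of evaluation,
    and the bound is one-sided because sublinearity bounds a sum only from
    above. *)
Definition diagonal_upper (T : nat -> continuousType S R -> continuousType S R)
    (q : S -> continuousType S R) : Prop :=
  forall e : R, 0 < e -> \forall n \near \oo, forall x, T n (q x) x <= q x x + e.

Section Korovkin.
Context (T : nat -> continuousType S R -> continuousType S R)
  (Tsub : forall n, sublinear_operator (T n)).

Lemma diagonal_upperZ (a : S -> R) (M : R) g :
  0 <= M -> (forall x, 0 <= a x <= M) -> tends_uniformly (fun n => T n g) g ->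
  diagonal_upper T (fun x => a x *: g).
Proof.
move=> M0 aM /tends_uniformlyP Tg e e0.
have M1 : 0 < M + 1 by rewrite ltr_wpDl.
apply: filterS (Tg _ (divr_gt0 e0 M1)) => n Tgn x; have /andP[a0 axM] := aM x.
rewrite (Tsub n).2 // !cts_scaleE -lerBlDl -mulrBr.
apply: le_trans (ler_mul_div_succ M0 (ltW e0)).
apply: le_trans (ler_wpM2l a0 (le_trans (ler_norm _) (Tgn x))) _.
by rewrite ler_wpM2r // ltW // divr_gt0.
Qed.

Lemma diagonal_upperD p q :
  diagonal_upper T p -> diagonal_upper T q ->
  diagonal_upper T (fun x => p x + q x).
Proof.
move=> Tp Tq e e0; have e20 : 0 < e / 2 by rewrite divr_gt0.
apply: filterS2 (Tp _ e20) (Tq _ e20) => n pn qn x.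
rewrite (le_trans ((Tsub n).1 _ _ x)) // !cts_addE.
have := pn x; have := qn x; lra.
Qed.

Lemma sublinear0 n : T n 0 = 0.
Proof. by have := (Tsub n).2 0 0 (lexx 0); rewrite !scale0r. Qed.

Lemma diagonal_upper_sum (I : Type) (r : seq I)
    (q : I -> S -> continuousType S R) :
  (forall i, diagonal_upper T (q i)) ->
  diagonal_upper T (fun x => \sum_(i <- r) q i x).
Proof.
move=> Tq; elim: r => [|i r IH].
  move=> e e0; apply: filterE => n x.
  by rewrite big_nil sublinear0 cts_zeroE add0r ltW.
rewrite (_ : (fun x => _) = fun x => q i x + \sum_(j <- r) q j x).
  exact: diagonal_upperD.
by apply/funext => x; rewrite big_cons.
Qed.

Context (Tmono : forall n, monotone_operator (T n)).

(** The hypothesis bounds f above, and the constant [f x] above, by combinations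
    of 1, q and f; nonnegativity of [f x] is what lets T be applied to them. *)
Lemma sublinear_monotone_pointwise n (q : continuousType S R) f (e c : R) x :
  0 <= f x -> 0 <= e -> 0 <= c ->
  (forall t, `|f t - f x| <= e + c * q t) ->
  `|T n f x - f x| <= f x * `|T n 1 x - 1| + (e * T n 1 x + c * T n q x).
Proof.
move=> fx0 e0 c0 fq.
have [Tadd TZ] := Tsub n.
have upper : T n f x <= (f x + e) * T n 1 x + c * T n q x.
  rewrite -2!cts_scaleE -TZ ?addr_ge0 // -(TZ c) // -cts_addE.
  apply: le_trans (Tadd _ _ x); apply: Tmono => t.
  rewrite cts_addE !cts_scaleE cts_oneE mulr1.
  by have := fq t; rewrite ler_norml; lra.
have lower : f x * T n 1 x <= T n f x + (e * T n 1 x + c * T n q x).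
  rewrite -!cts_scaleE -(TZ (f x)) // -(TZ e) // -(TZ c) //.
  apply: (@le_trans _ _ (T n (f + (e *: (1 : continuousType S R) + c *: q)) x)).
    apply: Tmono => t; rewrite !cts_addE !cts_scaleE cts_oneE !mulr1.
    by have := fq t; rewrite ler_norml; lra.
  by apply: le_trans (Tadd _ _ x) _; rewrite cts_addE lerD2l; exact: Tadd.
have : `|f x * (T n 1 x - 1)| <= f x * `|T n 1 x - 1|.
  by rewrite normrM (ger0_norm fx0).
rewrite !ler_norml; lra.
Qed.

Context (T1 : tends_uniformly (fun n => T n 1) 1).

(** Any nonnegative, jointly continuous q vanishing exactly on the diagonal can
    play the role of the squared distance, as long as [T n (q x) x] becomes
    small. *)
Lemma korovkin_nonneg (q : S -> continuousType S R) :
  compact [set: S] -> continuous (fun p : S * S => q p.1 p.2) ->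
  (forall x t, 0 <= q x t) -> (forall x t, q x t = 0 <-> x = t) ->
  diagonal_upper T q ->
  forall f, ctsle 0 f -> tends_uniformly (fun n => T n f) f.
Proof.
move=> cS cq q0 qsep Tq f f0; apply/tends_uniformlyP => e e0.
have [M M0 fM] := continuous_compact_bounded f cS.
have e40 : 0 < e / 4 by rewrite divr_gt0.
have [c c0 fc] := compact_modulus f cS cq q0 (fun x t => (qsep x t).1) e40.
have M1 : 0 < M + 1 by rewrite ltr_wpDl.
have c1 : 0 < c + 1 by rewrite ltr_wpDl.
have /tends_uniformlyP T1n := T1.
(* The bound 1 only serves to have T n 1 <= 2; e / 4 / (M + 1) is for the product
   with f, and c + 1 replaces c because c may vanish. *)
apply: filterS3 (T1n 1 ltr01) (T1n _ (divr_gt0 e40 M1))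
  (Tq _ (divr_gt0 e40 c1)).
move=> n T1x T1y Tqx x.
apply: le_trans (sublinear_monotone_pointwise n (f0 x) (ltW e40) c0 (fc x)) _.
have h1 : f x * `|T n 1 x - 1| <= e / 4.
  apply: le_trans (ler_mul_div_succ M0 (ltW e40)).
  apply: ler_pM => //; first exact: f0.
  exact: le_trans (ler_norm _) (fM x).
have h2 : e / 4 * T n 1 x <= e / 2.
  have : T n 1 x <= 2.
    by have := T1x x; rewrite cts_oneE ler_norml; lra.
  by nra.
have h3 : c * T n (q x) x <= e / 4.
  have := Tqx x; rewrite (qsep x x).2 // add0r => Tqx'.
  by apply: le_trans (ler_wpM2l c0 Tqx') (ler_mul_div_succ c0 (ltW e40)).
lra.
Qed.

Lemma translatable_shift (M : R) f :
  (forall n, translatable_operator (T n)) -> 0 <= M ->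
  tends_uniformly (fun n => T n (f + M *: (1 : continuousType S R)))
    (f + M *: (1 : continuousType S R)) ->
  tends_uniformly (fun n => T n f) f.
Proof.
move=> Ttr M0 /tends_uniformlyP TfM; apply/tends_uniformlyP => e e0.
have M1 : 0 < M + 1 by rewrite ltr_wpDl.
have e20 : 0 < e / 2 by rewrite divr_gt0.
have /tends_uniformlyP T1n := T1.
apply: filterS2 (TfM _ e20) (T1n _ (divr_gt0 e20 M1)) => n TfMn T1n' x.
have h : `|M * (T n 1 x - 1)| <= e / 2.
  rewrite normrM (ger0_norm M0).
  exact: le_trans (ler_wpM2l M0 (T1n' x)) (ler_mul_div_succ M0 (ltW e20)).
move: (TfMn x) h; rewrite Ttr // !cts_addE !cts_scaleE cts_oneE.
rewrite !ler_norml; lra.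
Qed.

End Korovkin.
End UniformEstimates.

(** * The squared Euclidean distance *)

Section SquaredDistance.
Context {R : realType} {N : nat} (X : set 'rV[R]_N).

(** [sqdistE] gives the usual formula.  This form is a combination of the test
    functions with nonnegative coefficients depending on x. *)
Definition sqdist (x : X) : continuousType X R :=
  (\sum_(k < N) pr X k ^+ 2) x *: (1 : continuousType X R) +
  (\sum_(k < N) pr X k ^+ 2 +
   \sum_(k < N) ((`|pr X k x| + pr X k x) *: (- pr X k) +
                 (`|pr X k x| - pr X k x) *: pr X k)).

Lemma sqdistE x t : sqdist x t = \sum_(k < N) (pr X k t - pr X k x) ^+ 2.
Proof.
rewrite /sqdist !cts_addE cts_scaleE cts_oneE mulr1 !cts_sumE -!big_split.
apply: eq_bigr => k _; rewrite cts_addE !cts_scaleE cts_oppE !cts_exprE.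
move: (pr X k x) (pr X k t) => a b /=; ring.
Qed.

Lemma sqdist_ge0 x t : 0 <= sqdist x t.
Proof. by rewrite sqdistE sumr_ge0 // => k _; exact: sqr_ge0. Qed.

Lemma sqdist_eq0 x t : sqdist x t = 0 <-> x = t.
Proof.
rewrite sqdistE; split => [xt|->]; last first.
  by rewrite big1 // => k _; rewrite subrr expr0n.
apply: val_inj; apply/rowP => k.
have /(_ k isT)/eqP :=
  psumr_eq0P (fun k _ => sqr_ge0 (pr X k t - pr X k x)) xt.
by rewrite sqrf_eq0 subr_eq0 => /eqP /esym.
Qed.

Lemma continuous_sqdist : continuous (fun p : X * X => sqdist p.1 p.2).
Proof.
rewrite (_ : (fun _ => _) =
    fun p : X * X => \sum_(k < N) (pr X k p.2 - pr X k p.1) ^+ 2); last first.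
  by apply/funext => p; rewrite sqdistE.
apply: continuous_big => [|k _ p]; first exact: add_continuous.
by apply: cvgM; exact: continuous_increment.
Qed.

Lemma diagonal_upper_sqdist T :
  compact X ->
  (forall n, sublinear_operator (T n)) ->
  tends_uniformly (fun n => T n 1) 1 ->
  (forall k : 'I_N, tends_uniformly (fun n => T n (pr X k)) (pr X k)) ->
  (forall k : 'I_N, tends_uniformly (fun n => T n (- pr X k)) (- pr X k)) ->
  tends_uniformly (fun n => T n (\sum_(k < N) pr X k ^+ 2))
    (\sum_(k < N) pr X k ^+ 2) ->
  diagonal_upper T sqdist.
Proof.
move=> /compact_set_type cX Tsub T1 Tpr TprN TQ.
have dZ := diagonal_upperZ Tsub.
apply: diagonal_upperD => //.
  have [M M0 QM] := continuous_compact_bounded (\sum_(k < N) pr X k ^+ 2) cX.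
  apply: (dZ _ M) => // x; rewrite (le_trans (ler_norm _) (QM x)) andbT.
  by rewrite cts_sumE sumr_ge0 // => k _; rewrite cts_exprE sqr_ge0.
apply: diagonal_upperD => //.
  move=> e e0; move/tends_uniformlyP : TQ => /(_ e e0).
  apply: filterS => n TQn x; rewrite -lerBlDl.
  exact: le_trans (ler_norm _) (TQn x).
apply: diagonal_upper_sum => // k.
have [M M0 prM] := continuous_compact_bounded (pr X k) cX.
apply: diagonal_upperD => //; apply: (dZ _ (M + M)); rewrite ?addr_ge0 // => x;
  have := prM x; have := ler_norm (pr X k x); have := ler_norm (- pr X k x);
  rewrite normrN; lra.
Qed.

End SquaredDistance.

(** * The theorem *)

Theorem theorem1 (R : realType) (N : nat) (X : set 'rV[R]_N)
    (T : nat -> continuousType X R -> continuousType X R) :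
  compact X ->
  (forall n, sublinear_operator (T n)) ->
  (forall n, monotone_operator (T n)) ->
  tends_uniformly (fun n => T n 1) 1 ->
  (forall k : 'I_N, tends_uniformly (fun n => T n (pr X k)) (pr X k)) ->
  (forall k : 'I_N, tends_uniformly (fun n => T n (- pr X k)) (- pr X k)) ->
  tends_uniformly (fun n => T n (\sum_(k < N) pr X k ^+ 2))
    (\sum_(k < N) pr X k ^+ 2) ->
  (forall f : continuousType X R, ctsle 0 f ->
     tends_uniformly (fun n => T n f) f) /\
  ((forall n, translatable_operator (T n)) ->
   forall f : continuousType X R, tends_uniformly (fun n => T n f) f).
Proof.
move=> cX Tsub Tmono T1 Tpr TprN TQ.
have cS := compact_set_type cX.
have Tpos (f : continuousType X R) : ctsle 0 f ->
    tends_uniformly (fun n => T n f) f.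
  exact: (korovkin_nonneg Tsub Tmono T1 cS (@continuous_sqdist _ _ X)
    (@sqdist_ge0 _ _ X) (@sqdist_eq0 _ _ X)
    (diagonal_upper_sqdist cX Tsub T1 Tpr TprN TQ)).
split=> // Ttr f.
have [M M0 fM] := continuous_compact_bounded f cS.
apply: (translatable_shift T1 Ttr M0); apply: Tpos => t.
rewrite cts_addE cts_scaleE cts_oneE mulr1 cts_zeroE.
by have := fM t; rewrite ler_norml; lra.
Qed.
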